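(* The category $\mathbf{KSob}$ of all $k$-bounded sober spaces with continuous mappings is not reflective in the category $\mathbf{Top_0}$ of all $T_0$ spaces with continuous mappings.
   Context: The specialization order of a $T_0$ space $X$ is $x\le y$ iff $x\in\mathrm{cl}(\{y\})$; $\downarrow x=\{y\in X: y\le x\}=\mathrm{cl}(\{x\})$, and $\bigvee F$ denotes the supremum of $F$ with respect to the specialization order. A nonempty subset $A$ of $X$ is irreducible if for any closed sets $F_1,F_2$, $A\subseteq F_1\cup F_2$ implies $A\subseteq F_1$ or $A\subseteq F_2$. A $T_0$ space $X$ is $k$-bounded sober if for any irreducible closed subset $F$ of $X$ whose supremum $\bigvee F$ exists, there is a unique point $x\in X$ such that $F=\downarrow x$. A full subcategory $\mathbf{K}$ of $\mathbf{Top_0}$ is reflective if for each $X\in\mathbf{Top_0}$ there are $X^k\in\mathbf{K}$ and a continuous mapping $\mu_X:X\to X^k$ such that for every continuous mapping $f:X\to Z$ with $Z\in\mathbf{K}$ there is a unique continuous mapping $g:X^k\to Z$ with $g\circ\mu_X=f$. *)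

(* Defs.v *)
From mathcomp Require Import all_boot all_order all_algebra.
From mathcomp Require Import all_classical all_reals all_analysis.

Set Implicit Arguments.
Unset Strict Implicit.
Unset Printing Implicit Defensive.

Local Open Scope classical_set_scope.

(* The objects of Top_0. *)
Record T0_space := T0Space {
  T0_sort :> topologicalType;
  T0_axiom : kolmogorov_space T0_sort
}.

Section Specialization.
Variable X : T0_space.
Implicit Types (x y s : X) (A F : set X).

Definition spec_le x y : Prop := closure [set y] x.

Definition spec_down x : set X := [set y | spec_le y x].

Definition spec_ubound F x : Prop := forall y, F y -> spec_le y x.

Definition spec_is_sup F s : Prop :=
  spec_ubound F s /\ forall x, spec_ubound F x -> spec_le s x.

Definition irreducible_set A : Prop :=
  A !=set0 /\
  forall F1 F2 : set X, closed F1 -> closed F2 ->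
    A `<=` F1 `|` F2 -> A `<=` F1 \/ A `<=` F2.

Definition k_bounded_sober : Prop :=
  forall F : set X, irreducible_set F -> closed F ->
    (exists s, spec_is_sup F s) -> exists! x, F = spec_down x.

End Specialization.

(* A full subcategory of Top_0 is given by its class K of objects.  Classes are
   typed T0_space -> Prop, not set T0_space, so that the universe of the points
   of spaces need not lie strictly below that of classical_sets.set. *)
Definition reflective (K : T0_space -> Prop) : Prop :=
  forall X : T0_space,
  exists (Xk : T0_space) (mu : X -> Xk),
    [/\ K Xk, continuous mu
      & forall (Z : T0_space) (f : X -> Z), K Z -> continuous f ->
          exists! g : Xk -> Z, continuous g /\ g \o mu = f].

Definition KSob (X : T0_space) : Prop := k_bounded_sober X.

(* Main.v *)
Require Import Defs.
From HB Require Import structures.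
From mathcomp Require Import all_boot all_order all_algebra.
From mathcomp Require Import all_classical all_reals all_analysis.

(** A reflective full subcategory closed under isomorphism is closed under
    retracts: if E is a retract of some Y in K, then extending the section
    E -> Y along mu : E -> E^k and composing with the retraction Y -> E gives
    an inverse of mu.  Let E be the chain of natural numbers with one top
    element added and Y the same chain with two incomparable upper bounds
    added, both with the Alexandrov topology of up-closed sets.  The chain is
    irreducible and closed but not principal; it has a supremum in E and none
    in Y.  Hence Y is k-bounded sober, its retract E is not. *)

Set Implicit Arguments.
Unset Strict Implicit.
Unset Printing Implicit Defensive.

Local Open Scope classical_set_scope.

Section Specialization.
Implicit Types X Y : T0_space.

Lemma spec_leP X (x y : X) :
  spec_le x y <-> forall U : set X, open U -> U x -> U y.
Proof.
split=> [xy U Uo Ux|h B].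
  by have [_ [/= -> Uy]] := xy U (open_nbhs_nbhs (conj Uo Ux)).
by rewrite nbhsE => -[U [Uo Ux] UB]; exists y; split=> //; apply/UB/(h U).
Qed.

Lemma spec_le_refl X (x : X) : spec_le x x.
Proof. exact/spec_leP. Qed.

Lemma spec_le_anti X (x y : X) : spec_le x y -> spec_le y x -> x = y.
Proof.
move=> xy yx; apply/eqP/negPn/negP => /T0_axiom [A] [] [];
  rewrite !inE => Ax nAy.
- by have [_ [/= -> Ay]] := xy A Ax; apply: nAy.
- by have [_ [/= -> Ay]] := yx A Ax; apply: nAy.
Qed.

Lemma spec_down_inj X : injective (@spec_down X).
Proof.
move=> x y xy; apply: spec_le_anti.
- by have : spec_down x x := @spec_le_refl X x; rewrite xy.
- by have : spec_down y y := @spec_le_refl X y; rewrite -xy.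
Qed.

Lemma continuous_spec_le X Y (f : X -> Y) : continuous f ->
  {homo f : x y / spec_le x y}.
Proof.
move=> /continuousP fc x y /spec_leP xy; apply/spec_leP => U Uo Ufx.
exact: (xy (f @^-1` U) (fc _ Uo)).
Qed.

(** Uniqueness of the generating point comes for free from the $T_0$ axiom, by [spec_down_inj]. *)
Lemma k_bounded_soberP X : k_bounded_sober X <->
  forall F : set X, irreducible_set F -> closed F ->
    (exists s, spec_is_sup F s) -> exists x, F = spec_down x.
Proof.
split=> h F Fi Fc Fs; have [x Fx] := h F Fi Fc Fs.
  by exists x; have [] := Fx.
by exists x; split=> // y Fy; apply: spec_down_inj; rewrite -Fx.
Qed.

(** Needed because [reflective_retract], for an arbitrary class [K], only puts a homeomorphic copy
    of the retract in [K]. *)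
Lemma k_bounded_sober_homeo X Y (f : X -> Y) (g : Y -> X) :
  continuous f -> continuous g -> cancel f g -> cancel g f ->
  k_bounded_sober Y -> k_bounded_sober X.
Proof.
move=> fc gc fK gK /k_bounded_soberP Yk.
have fle := continuous_spec_le fc; have gle := continuous_spec_le gc.
apply/k_bounded_soberP => F [[a Fa] Fi] Fc [s [sub slub]].
have [||| y Fy] := Yk (g @^-1` F).
- split; first by exists (f a); rewrite /= fK.
  move=> F1 F2 F1c F2c F12.
  have [||x Fx|h|h] := Fi (f @^-1` F1) (f @^-1` F2).
  + by move/continuous_closedP: fc; apply.
  + by move/continuous_closedP: fc; apply.
  + by apply: F12; rewrite /= fK.
  + by left=> z /h; rewrite /= gK.
  + by right=> z /h; rewrite /= gK.
- by move/continuous_closedP: gc; apply.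
- exists (f s); split=> [z /= /sub /fle|z zub]; first by rewrite gK.
  rewrite -(gK z); apply/fle/slub => x Fx.
  by rewrite -(fK x); apply/gle/zub; rewrite /= fK.
exists (g y); apply/seteqP; split=> x.
- move=> Fx; rewrite -(fK x); apply/gle.
  by have : (g @^-1` F) (f x) by [rewrite /= fK]; rewrite Fy.
- move=> /fle; rewrite gK => xy; rewrite -(fK x).
  by have : spec_down y (f x) by []; rewrite -Fy.
Qed.

Lemma reflective_retract (K : T0_space -> Prop) X Y
    (i : X -> Y) (r : Y -> X) :
  reflective K -> K Y -> continuous i -> continuous r -> cancel i r ->
  exists (Z : T0_space) (f : X -> Z) (g : Z -> X),
    [/\ K Z, continuous f /\ continuous g, cancel f g & cancel g f].
Proof.
move=> /(_ X) [Z [mu [KZ muc muU]]] KY ic rc iK.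
have [j [[jc jmu] _]] := muU Y i KY ic.
have gmu : cancel mu (r \o j).
  by move=> x; rewrite -[RHS]iK -jmu.
have gc : continuous (r \o j).
  by move=> z; apply: continuous_comp; [exact: jc|exact: rc].
exists Z, mu, (r \o j); split=> // z.
(* Both [mu \o (r \o j)] and the identity extend [mu] along itself, so uniqueness identifies each
   with [h]. *)
have [h [_ hU]] := muU Z mu KZ muc.
have -> : mu ((r \o j) z) = h z.
  rewrite (hU (mu \o (r \o j)))//; split.
    by move=> t; apply: continuous_comp; [exact: gc|exact: muc].
  by apply/funext => x; congr mu; exact: gmu.
by rewrite (hU id)//; split=> // t; exact: cvg_id.
Qed.

End Specialization.

(** The chain of natural numbers with an antichain T of upper bounds added. *)
Definition capped (T : Type) : Type := (nat + T)%type.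

HB.instance Definition _ (T : choiceType) :=
  Choice.copy (capped T) (nat + T)%type.

Section Capped.
Variable T : choiceType.
Implicit Types (x y : capped T) (U F : set (capped T)) (n : nat).

Definition capped_le x y : Prop :=
  match x, y with
  | inl m, inl n => (m <= n)%N
  | inl _, inr _ => True
  | inr s, inr t => s = t
  | inr _, inl _ => False
  end.

Lemma capped_le_refl x : capped_le x x.
Proof. by case: x => /=. Qed.

Lemma capped_le_trans y x z : capped_le x y -> capped_le y z -> capped_le x z.
Proof.
by case: x y z => [m|s] [n|t] [p|u] //=; [exact: leq_trans|move=> ->].
Qed.

Lemma capped_le_anti x y : capped_le x y -> capped_le y x -> x = y.
Proof.
case: x y => [m|s] [n|t] //=; last by move=> ->.
by move=> mn nm; congr inl; apply/eqP; rewrite eqn_leq mn nm.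
Qed.

Definition capped_open U : Prop := forall x y, capped_le x y -> U x -> U y.

Lemma capped_openT : capped_open setT.
Proof. by []. Qed.

Lemma capped_openI : setI_closed capped_open.
Proof.
by move=> A B Ao Bo x y xy [Ax Bx]; split; [apply: Ao Ax|apply: Bo Bx].
Qed.

Lemma capped_open_bigcup (I : Type) (f : I -> set (capped T)) :
  (forall i, capped_open (f i)) -> capped_open (\bigcup_i f i).
Proof. by move=> fo x y xy [i _ fx]; exists i => //; apply: fo fx. Qed.

HB.instance Definition _ := isOpenTopological.Build (capped T)
  capped_openT capped_openI capped_open_bigcup.

Lemma open_capped U : open U <-> capped_open U.
Proof. by []. Qed.

Lemma closed_capped F :
  closed F <-> forall x y, capped_le x y -> F y -> F x.
Proof.
rewrite -openC; split=> [/open_capped h x y xy Fy|h].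
  by apply: contrapT => nFx; exact: (h x y xy nFx).
by apply/open_capped => x y xy nFx /(h _ _ xy).
Qed.

Lemma capped_kolmogorov : kolmogorov_space (capped T).
Proof.
have nbhs_up x : nbhs x (capped_le x).
  apply: open_nbhs_nbhs; split; last exact: capped_le_refl.
  by apply/open_capped => y z yz /capped_le_trans; apply.
move=> x y /eqP xy; have [le_xy|nle] := pselect (capped_le x y).
- exists (capped_le y); right; rewrite !inE; split; first exact: nbhs_up.
  by move=> le_yx; apply: xy; exact: capped_le_anti.
- by exists (capped_le x); left; rewrite !inE; split; first exact: nbhs_up.
Qed.

Definition capped_space : T0_space := T0Space capped_kolmogorov.

Lemma spec_le_capped (x y : capped_space) : spec_le x y <-> capped_le x y.
Proof.
split=> [/spec_leP/(_ (capped_le x))|xy].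
  apply; last exact: capped_le_refl.
  by apply/open_capped => y' z yz /capped_le_trans; apply.
by apply/spec_leP => U /open_capped; apply.
Qed.

(** By maximality of [x], the closed sets [spec_down x] and the complement of the up-set of [x]
    cover [F]. The second one misses [x], so irreducibility leaves the first. *)
Lemma irreducible_max (F : set capped_space) (x : capped_space) :
  irreducible_set F -> closed F ->
  F x -> (forall y, F y -> capped_le x y -> y = x) -> F = spec_down x.
Proof.
move=> [_ Fi] /closed_capped Fdown Fx xmax.
have [|||Fd|Fd] := Fi (spec_down x) (~` capped_le x).
- exact: closed_closure.
- by apply/open_closedC/open_capped => y z yz /capped_le_trans; apply.
- move=> y Fy; have [xy|] := pselect (capped_le x y); last by right.
  by rewrite (xmax _ Fy xy); left; exact: spec_le_refl.
- apply/seteqP; split=> // y /spec_le_capped yx; exact: Fdown yx Fx.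
- by have := Fd _ Fx (capped_le_refl x).
Qed.

(* Two distinct caps leave the chain without a least upper bound. *)
Lemma capped_k_bounded_sober (t1 t2 : T) :
  t1 <> t2 -> k_bounded_sober capped_space.
Proof.
move=> t12; apply/k_bounded_soberP => F Fi Fc [s [sub slub]].
have [[x [Fx xmax]]|nmax] :=
    pselect (exists x, F x /\ forall y, F y -> capped_le x y -> y = x).
  by exists x; exact: irreducible_max.
(* Caps are maximal, so an [F] without maximal element lies in the chain and every cap bounds it. *)
have Fchain y : F y -> exists n, y = inl n.
  case: y => [n|t] Ft; first by exists n.
  by case: nmax; exists (inr t); split=> // -[//|u] _ /= ->.
have Fub t : spec_ubound F (inr t : capped_space).
  by move=> y /Fchain[n ->]; apply/spec_le_capped.
have /spec_le_capped s1 := slub _ (Fub t1).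
have /spec_le_capped s2 := slub _ (Fub t2).
(* Being below two distinct caps, [s] is a number [m]. Then [F] is a nonempty set of numbers bounded
   by [m], and its greatest element contradicts [nmax]. *)
case: s s1 s2 sub {slub} => [m _ _|s /= -> //] sub.
case: nmax; have [[a Fa] _] := Fi.
have exF : exists n, `[< F (inl n : capped T) >].
  by have [n an] := Fchain _ Fa; exists n; apply/asboolP; rewrite -an.
have bound n : `[< F (inl n : capped T) >] -> (n <= m)%N.
  by move=> /asboolP /sub /spec_le_capped.
have [p /asboolP Fp pmax] := ex_maxnP exF bound.
exists (inl p); split=> // y Fy; have [q qy] := Fchain _ Fy.
rewrite qy in Fy *; move=> /= pq; congr inl; apply/eqP.
by rewrite eqn_leq pq pmax//; apply/asboolP.
Qed.

End Capped.

(** Any [h] gives a monotone map, since comparable caps are equal. This yields both the section and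
    the retraction. *)
Lemma capped_map_continuous (S T : choiceType) (h : S -> T) :
  continuous (fun x : capped_space S =>
    match x with inl n => inl n | inr s => inr (h s) end : capped_space T).
Proof.
apply/continuousP => U /open_capped Uo; apply/open_capped => x y xy.
by apply: Uo; case: x y xy => [m|s] [n|t] //= ->.
Qed.

Lemma capped_unit_not_k_bounded_sober : ~ k_bounded_sober (capped_space unit).
Proof.
pose F : set (capped_space unit) := [set x | exists n, x = inl n].
move=> /k_bounded_soberP /(_ F) [|||x Fx].
- split; first by exists (inl 0); exists 0.
  move=> F1 F2 /closed_capped F1d /closed_capped F2d F12.
  have [h|] := pselect (forall n, F1 (inl n : capped unit)).
    by left=> _ [n ->].
  move=> /existsNP[n nF1]; right=> _ [p ->].
  (* A point above both [n] and [p]: down-closedness keeps it out of [F1], hence it is in [F2] and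
     brings [p] along. *)
  have [|h|h] := F12 (inl (maxn n p)); first by exists (maxn n p).
  + by case: nF1; apply: F1d h => /=; exact: leq_maxl.
  + by apply: F2d h => /=; exact: leq_maxr.
- apply/closed_capped => x y xy [n yn]; move: xy; rewrite yn.
  by case: x => // m _; exists m.
(* The single cap is the supremum: no number [n] bounds the chain, because of [n.+1]. *)
- exists (inr tt); split=> [_ [n ->]|x xub]; first exact/spec_le_capped.
  apply/spec_le_capped; case: x xub => [n|[]] // /(_ (inl n.+1)) h.
  have /spec_le_capped /= : spec_le (inl n.+1 : capped_space unit) (inl n).
    by apply: h; exists n.+1.
  by rewrite ltnn.
(* A generator of [F] would be a greatest natural number. *)
- have : F x by rewrite Fx; exact: spec_le_refl.
  move=> [n xn]; have : F (inl n.+1) by exists n.+1.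
  by rewrite Fx xn => /spec_le_capped /=; rewrite ltnn.
Qed.

Theorem corollary3p8 : ~ reflective KSob.
Proof.
move=> KSobR; apply: capped_unit_not_k_bounded_sober.
have KY : KSob (capped_space bool).
  exact: (@capped_k_bounded_sober bool true false).
(* The first branch checks that merging the two caps undoes sending the single cap to [true]. *)
have [[n|[]]//|Z [f [g [KZ [fc gc] fK gK]]]] := reflective_retract KSobR KY
  (@capped_map_continuous unit bool (fun=> true))
  (@capped_map_continuous bool unit (fun=> tt)).
exact: k_bounded_sober_homeo fc gc fK gK KZ.
Qed.
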